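(* Let $\mathcal L$ be the generator of a primitive symmetric quantum Markov semigroup on $\mathcal B(\mathcal H)$, $\dim\mathcal H=d$, with carré du champ operator $\Gamma$. Suppose that for every $p\in(1,2]$ the $p$-Beckner inequality holds with a constant $\alpha_p\ge a(p-1)^s$, for some $a>0$ and $s\ge0$ (independent of $p$). Then for every self-adjoint $X\in\mathcal B(\mathcal H)$ and every $r\ge2$, $$\Big\|X-\tfrac1d\mathrm{Tr}(X)\mathbf 1\Big\|_{r,\mathbf 1/d}^2\ \le\ \frac{r^{s+1}\kappa(s)}{2a}\,\|\Gamma(X)\|_{r/2,\mathbf 1/d},\qquad \kappa(s):=\big(1-e^{-(s+1)/2}\big)^{-1}.$$
   Context: $\mathcal H$ is a finite-dimensional Hilbert space of dimension $d$. A quantum Markov semigroup (QMS) is a $C_0$-semigroup $\mathcal P_t=e^{t\mathcal L}$ of completely positive unital maps on $\mathcal B(\mathcal H)$; it is symmetric if $\mathcal P_t=\mathcal P_t^\dagger$ (adjoint for the Hilbert–Schmidt inner product), in which case $\mathbf 1/d$ is invariant; it is primitive if it has a unique invariant state and this is full rank (here $\mathbf 1/d$). The carré du champ is $\Gamma(X,Y)=\frac12\big(\mathcal L(X^*Y)-X^*\mathcal L(Y)-\mathcal L(X)^*Y\big)$ and $\Gamma(X)=\Gamma(X,X)$. The normalized Schatten norm is $\|X\|_{p,\mathbf 1/d}=\big(\frac1d\mathrm{Tr}(|X|^p)\big)^{1/p}$. For $p\in(1,2]$, $\hat p=p/(p-1)$ and $X\ge0$ let $\mathcal E_{p,\mathcal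 L}(X)=-\frac{\hat p\,p}{4}\cdot\frac1d\mathrm{Tr}\big(X^{p-1}\mathcal L(X)\big)$. The $p$-Beckner inequality with constant $\alpha_p$ is $\alpha_p\,\hat p\,\big(\|X\|_{p,\mathbf 1/d}^p-\|X\|_{1,\mathbf 1/d}^p\big)\le\mathcal E_{p,\mathcal L}(X)$ for all $X>0$. *)

(* Defs.v *)
From HB Require Import structures.
From mathcomp Require Import all_boot all_order all_algebra.
From mathcomp Require Import sesquilinear spectral complex.
From mathcomp Require Import all_classical all_reals all_analysis.
Set Implicit Arguments.
Unset Strict Implicit.
Unset Printing Implicit Defensive.
Import Order.TTheory GRing.Theory Num.Theory.
Import numFieldNormedType.Exports.
Local Open Scope classical_set_scope.
Local Open Scope ring_scope.
Local Open Scope complex_scope.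
Local Open Scope sesquilinear_scope.

(* Seeing R[i] through numClosedFieldType is what gives R[i], and hence
   'M[R[i]]_d, its norm topology. *)
Definition C (R : realType) : numClosedFieldType := R[i].

(* B(H), for H = C^d *)
Notation "''B' [ R ]_ d" := 'M[C R]_d
  (at level 8, d at level 2, format "''B' [ R ]_ d") : type_scope.

Definition psdmx (R : realType) (n : nat) (A : 'B[R]_n) : Prop :=
  A \is hermsymmx /\ forall v : 'cV[C R]_n, 0 <= (v^t* *m A *m v) 0 0.

Definition pdmx (R : realType) (n : nat) (A : 'B[R]_n) : Prop :=
  A \is hermsymmx /\
  forall v : 'cV[C R]_n, v != 0 -> 0 < (v^t* *m A *m v) 0 0.

(* Functional calculus f(A) for self-adjoint A: f is applied to the (real)
   eigenvalues in the spectral decomposition of A. *)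
Definition funmx (R : realType) (n : nat) (f : R -> R) (A : 'B[R]_n) :
    'B[R]_n :=
  invmx (spectralmx A)
    *m diag_mx (map_mx (fun z : C R => (f (complex.Re z))%:C)
                       (spectral_diag A))
    *m spectralmx A.

Definition powmx (R : realType) (n : nat) (A : 'B[R]_n) (p : R) : 'B[R]_n :=
  funmx (fun x => x `^ p) A.

Definition absmx (R : realType) (n : nat) (X : 'B[R]_n) : 'B[R]_n :=
  funmx Num.sqrt (X^t* *m X).

(* (1/d) Tr. The real part is taken only of traces that are real, namely
   Tr |X|^p, and Tr (A B) with A, B self-adjoint. *)
Definition ntr (R : realType) (d : nat) (X : 'B[R]_d) : R :=
  d%:R^-1 * complex.Re (\tr X).

Definition nschatten (R : realType) (d : nat) (p : R) (X : 'B[R]_d) : R :=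
  (ntr (powmx (absmx X) p)) `^ p^-1.

(* Phi (x) id_k is positive for every k; an element of B(H) (x) M_k is a k x k
   block matrix with entries in B(H). *)
Definition completely_positive (R : realType) (d : nat)
    (Phi : 'B[R]_d -> 'B[R]_d) : Prop :=
  forall (k : nat) (A : 'I_k -> 'I_k -> 'B[R]_d),
    psdmx (\mxblock_(i < k, j < k) A i j) ->
    psdmx (\mxblock_(i < k, j < k) Phi (A i j)).

(* Only the values P t with 0 <= t matter. *)
Definition quantum_markov_semigroup (R : realType) (d : nat)
    (P : R -> {linear 'B[R]_d -> 'B[R]_d}) : Prop :=
  [/\ forall X, P 0 X = X,
      forall s t X, 0 <= s -> 0 <= t -> P (s + t) X = P s (P t X),
      forall X, P t X @[t --> 0^'+] --> X,
      forall t, 0 <= t -> completely_positive (P t)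
    & forall t, 0 <= t -> P t 1%:M = 1%:M].

Definition generator (R : realType) (d : nat)
    (P : R -> {linear 'B[R]_d -> 'B[R]_d})
    (L : {linear 'B[R]_d -> 'B[R]_d}) : Prop :=
  forall X, (t^-1)%:C *: (P t X - X) @[t --> 0^'+] --> L X.

Definition symmetric_semigroup (R : realType) (d : nat)
    (P : R -> {linear 'B[R]_d -> 'B[R]_d}) : Prop :=
  forall t X Y, 0 <= t -> \tr (X^t* *m P t Y) = \tr ((P t X)^t* *m Y).

Definition invariant_state (R : realType) (d : nat)
    (P : R -> {linear 'B[R]_d -> 'B[R]_d}) (rho : 'B[R]_d) : Prop :=
  [/\ psdmx rho, \tr rho = 1
    & forall t X, 0 <= t -> \tr (rho *m P t X) = \tr (rho *m X)].

(* Forces 0 < d. *)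
Definition primitive (R : realType) (d : nat)
    (P : R -> {linear 'B[R]_d -> 'B[R]_d}) : Prop :=
  exists rho : 'B[R]_d,
    [/\ invariant_state P rho, \rank rho = d
      & forall sigma, invariant_state P sigma -> sigma = rho].

Definition carre_du_champ (R : realType) (d : nat)
    (L : 'B[R]_d -> 'B[R]_d) (X Y : 'B[R]_d) : 'B[R]_d :=
  2^-1 *: (L (X^t* *m Y) - X^t* *m L Y - (L X)^t* *m Y).

Definition conj_exponent (R : realType) (p : R) : R := p / (p - 1).

Definition p_dirichlet_form (R : realType) (d : nat)
    (L : 'B[R]_d -> 'B[R]_d) (p : R) (X : 'B[R]_d) : R :=
  - (conj_exponent p * p / 4) * ntr (powmx X (p - 1) *m L X).

Definition beckner_inequality (R : realType) (d : nat)
    (L : 'B[R]_d -> 'B[R]_d) (p alpha : R) : Prop :=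
  forall X : 'B[R]_d, pdmx X ->
    alpha * conj_exponent p * (nschatten p X `^ p - nschatten 1 X `^ p)
      <= p_dirichlet_form L p X.

Definition kappa (R : realType) (s : R) : R :=
  (1 - expR (- ((s + 1) / 2)))^-1.

(* Main.v *)
Require Import Defs.
From mathcomp Require Import all_boot all_order all_algebra.
From mathcomp Require Import ring lra.
From mathcomp Require Import sesquilinear spectral complex.
From mathcomp Require Import all_classical all_reals all_analysis.
Set Implicit Arguments.
Unset Strict Implicit.
Unset Printing Implicit Defensive.
Import Order.TTheory GRing.Theory Num.Theory.
Import numFieldNormedType.Exports.
Local Open Scope classical_set_scope.
Local Open Scope ring_scope.
Local Open Scope complex_scope.
Local Open Scope sesquilinear_scope.

(** Write the self-adjoint X in an orthonormal eigenbasis, with eigenvalues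
    x_i and spectral projections P_i, and put Q i j = <i| L(P_j) |i>.  The
    symmetry of the semigroup makes Q symmetric, positivity makes its
    off-diagonal entries nonnegative, and unitality makes its rows sum to 0
    ([symmetric_rates_in]).  On the operators that are diagonal in this basis, L
    therefore acts as the generator of a Markov chain which is reversible for
    the uniform law, its Dirichlet forms are those of the chain, and the
    diagonal of Gamma(X) is the carre du champ gamma of x for the chain
    ([diag_entry_carre_du_champ]).  Noncommutativity remains only in the norm of
    Gamma(X), where it is harmless: pinching to the diagonal decreases Schatten
    norms ([peierls]).

    For the chain, let N_q be the q-norm of a positive vector y whose increments
    are dominated by those of x.  The Beckner inequality of exponent
    p = q / (q - 1), applied to y^(q-1), bounds N_q^q - N_(q-1)^q by a multiple
    of the Dirichlet form E(y, y^(q-1)).  A two-point inequality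
    ([dirichlet_powR_le]) replaces the latter by the mean of y^(q-2) gamma, and
    Hoelder's inequality yields ([beckner_step])
      N_q^q <= N_(q-1)^q + q^(s+1) / (2 a) * |gamma|_(q/2) * N_q^(q-2).
    If the claim holds for q - 1, then (1 - 1/q)^q <= 1/e shows that the first
    term on the right is at most exp(-(s+1)/2) times the q-th power of the bound
    claimed for N_q, and kappa s is exactly the factor that absorbs it
    ([moment_absorb]).  Decreasing q by steps of 1 ends in [1, 2], where N_q <= N_2
    and the case p = 2 of the Beckner inequality is a spectral gap
    ([spectral_gap]).

    Since Beckner inequalities are about positive operators, y is taken to be
    |x - mean x| + delta, with delta tending to 0 in the end ([moment_bound]). *)

(** * Powers and uniform averages *)

(** The tangent line of a convex power, obtained from Young's inequality for u and
    m^(q-1).  Jensen's inequality and the two-point inequality both follow. *)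
Lemma powR_tangent (R : realType) (m u q : R) : 0 <= m -> 0 <= u -> 1 <= q ->
  m `^ q + q * m `^ (q - 1) * (u - m) <= u `^ q.
Proof.
move=> m0 u0; rewrite le_eqVlt => /predU1P[<-|q1].
  by rewrite subrr powRr0 !powRr1// !mul1r addrC subrK.
have q0 : 0 < q by lra.
have q10 : 0 < q - 1 by lra.
have := @conjugate_powR R u (m `^ (q - 1)) q (q / (q - 1)) u0 (powR_ge0 _ _) q0.
have -> : (m `^ (q - 1)) `^ (q / (q - 1)) = m `^ q.
  by rewrite -powRrM; congr powR; field; rewrite gt_eqF.
move=> /(_ (divr_gt0 q0 q10)) young.
have {young} : u * m `^ (q - 1) <= u `^ q / q + m `^ q / (q / (q - 1)).
  by apply: young; field; rewrite !gt_eqF.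
rewrite -(ler_pM2l q0) mulrDr.
have -> : q * (u `^ q / q) = u `^ q by field; rewrite gt_eqF.
have -> : q * (m `^ q / (q / (q - 1))) = (q - 1) * m `^ q.
  by field; rewrite !gt_eqF.
have := mulr_powRB1 m0 q0.
set A := m `^ (q - 1); set B := m `^ q; set D := u `^ q => e.
have -> : q * A * (u - m) = q * (u * A) - q * (m * A) by ring.
rewrite e; lra.
Qed.

(** Average the tangent line at the barycentre. *)
Lemma jensen_powR (R : realType) (I : finType) (l u : I -> R) (q : R) :
    (forall i, 0 <= l i) -> \sum_i l i = 1 -> (forall i, 0 <= u i) -> 1 <= q ->
  (\sum_i l i * u i) `^ q <= \sum_i l i * u i `^ q.
Proof.
move=> l0 l1 u0 q1; set m := \sum_i l i * u i.
have m0 : 0 <= m by apply: sumr_ge0 => i _; rewrite mulr_ge0.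
have -> : m `^ q = \sum_i l i * (m `^ q + q * m `^ (q - 1) * (u i - m)).
  transitivity (\sum_i (l i * (m `^ q - q * m `^ (q - 1) * m)
                        + (l i * u i) * (q * m `^ (q - 1)))).
    rewrite big_split/= -!mulr_suml l1 -/m; ring.
  by apply: eq_bigr => i _; ring.
by apply: ler_sum => i _; rewrite ler_wpM2l// powR_tangent.
Qed.

(** The tangent line at the larger argument bounds the difference of the (q-1)-th
    powers by the larger of the two derivatives; the sum of the two makes the bound symmetric
    in y and z. *)
Lemma two_point (R : realType) (y z q : R) : 0 < y -> 0 < z -> 2 <= q ->
  (y - z) * (y `^ (q - 1) - z `^ (q - 1))
    <= (q - 1) * (y - z) ^+ 2 * (y `^ (q - 2) + z `^ (q - 2)).
Proof.
move=> y0 z0 q2.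
wlog zy : y z y0 z0 / z <= y.
  move=> H; have [zy|/ltW yz] := leP z y; first exact: H.
  have := H z y z0 y0 yz.
  rewrite [z `^ (q - 2) + _]addrC -(sqrrN (z - y)) opprB; apply: le_trans.
  by rewrite -[z - y]opprB -[z `^ _ - y `^ _]opprB mulrNN.
have := @powR_tangent R y z (q - 1) (ltW y0) (ltW z0).
have -> : q - 1 - 1 = q - 2 by ring.
have q1 : 1 <= q - 1 by lra.
move=> /(_ q1); set A := y `^ (q - 1); set B := z `^ (q - 1).
set D := y `^ (q - 2) => t.
have C0 : 0 <= (q - 1) * (y - z) ^+ 2 * z `^ (q - 2).
  by rewrite !mulr_ge0 ?sqr_ge0 ?powR_ge0//; lra.
rewrite [leRHS]mulrDr; apply: (@le_trans _ _ ((q - 1) * (y - z) ^+ 2 * D)); last lra.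
have -> : (q - 1) * (y - z) ^+ 2 * D = (y - z) * ((q - 1) * D * (y - z)) by ring.
by rewrite ler_wpM2l ?subr_ge0//; lra.
Qed.

Lemma powRV (R : realType) (x q : R) : 0 <= x -> x^-1 `^ q = (x `^ q)^-1.
Proof. by move=> x0; rewrite -powR_inv1// powRAC powR_inv1 ?powR_ge0. Qed.

Definition mean (R : realType) (n : nat) (f : 'I_n -> R) : R :=
  n%:R^-1 * \sum_i f i.

Lemma mean_ge0 (R : realType) (n : nat) (f : 'I_n -> R) :
  (forall i, 0 <= f i) -> 0 <= mean f.
Proof. by move=> f0; rewrite mulr_ge0 ?invr_ge0// sumr_ge0. Qed.

Lemma eq_mean (R : realType) (n : nat) (f g : 'I_n -> R) :
  f =1 g -> mean f = mean g.
Proof. by move=> fg; rewrite /mean (eq_bigr g). Qed.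

Lemma le_mean (R : realType) (n : nat) (f g : 'I_n -> R) :
  (forall i, f i <= g i) -> mean f <= mean g.
Proof. by move=> fg; rewrite ler_wpM2l ?invr_ge0// ler_sum. Qed.

Lemma meanD (R : realType) (n : nat) (f g : 'I_n -> R) :
  mean (fun i => f i + g i) = mean f + mean g.
Proof. by rewrite /mean big_split mulrDr. Qed.

Lemma meanZ (R : realType) (n : nat) (c : R) (f : 'I_n -> R) :
  mean (fun i => c * f i) = c * mean f.
Proof. by rewrite /mean -mulr_sumr mulrCA. Qed.

Lemma mean_cst (R : realType) (n : nat) (c : R) : (0 < n)%N ->
  mean (fun _ : 'I_n => c) = c.
Proof.
move=> n0; rewrite /mean sumr_const card_ord -[c *+ n]mulr_natr mulrCA mulVf ?mulr1//.
by rewrite pnatr_eq0 -lt0n.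
Qed.

Lemma mean_gt0 (R : realType) (n : nat) (f : 'I_n -> R) : (0 < n)%N ->
  (forall i, 0 < f i) -> 0 < mean f.
Proof.
move=> n0 f0; rewrite mulr_gt0 ?invr_gt0 ?ltr0n//.
case: n n0 f f0 => // n _ f f0; rewrite big_ord_recl ltr_wpDr//.
by rewrite sumr_ge0// => i _; rewrite ltW.
Qed.

Lemma jensen_mean (R : realType) (n : nat) (u : 'I_n -> R) (q : R) :
    (0 < n)%N -> (forall i, 0 <= u i) -> 1 <= q ->
  mean u `^ q <= mean (fun i => u i `^ q).
Proof.
move=> n0 u0 q1; rewrite /mean !mulr_sumr; apply: jensen_powR => //.
by rewrite sumr_const card_ord -[_ *+ n]mulr_natr mulVf// pnatr_eq0 -lt0n.
Qed.

(** Monotonicity of normalized norms in the exponent, in a form where the bound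
    b is a free parameter, so that no roots appear. *)
Lemma mean_powR_mono (R : realType) (n : nat) (u : 'I_n -> R) (p q b : R) :
    (0 < n)%N -> (forall i, 0 <= u i) -> 0 < p -> p <= q -> 0 <= b ->
  mean (fun i => u i `^ q) <= b `^ q -> mean (fun i => u i `^ p) <= b `^ p.
Proof.
move=> n0 u0 p0 pq b0 uq.
have qp : 1 <= q / p by rewrite ler_pdivlMr// mul1r.
have qp0 : 0 < q / p by lra.
have epq : p * (q / p) = q by field; rewrite gt_eqF.
have := @jensen_mean R n (fun i => u i `^ p) (q / p) n0 (fun i => powR_ge0 _ _) qp.
rewrite (@eq_mean R n (fun i => (u i `^ p) `^ (q / p)) (fun i => u i `^ q)); last first.
  by move=> i; rewrite -powRrM epq.
have eb : b `^ q = (b `^ p) `^ (q / p) by rewrite -powRrM epq.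
move=> /le_trans /(_ uq); rewrite eb.
move=> h; rewrite leNgt; apply/negP => lt.
have := gt0_ltr_powR qp0 _ _ lt; rewrite !nnegrE ?powR_ge0//.
rewrite mean_ge0 => [|i]; last exact: powR_ge0.
by move=> /(_ isT isT); rewrite ltNge h.
Qed.

(** Hoelder's inequality for the conjugate exponents q / (q - 2) and q / 2: Young's
    inequality at each index for the normalized values y / Y and g / b. *)
Lemma mean_holder (R : realType) (n : nat) (y g : 'I_n -> R) (q Y b : R) :
    (0 < n)%N -> (forall i, 0 <= y i) -> (forall i, 0 <= g i) ->
    2 < q -> 0 < Y -> 0 < b ->
    mean (fun i => y i `^ q) <= Y `^ q ->
    mean (fun i => g i `^ (q / 2)) <= b `^ (q / 2) ->
  mean (fun i => y i `^ (q - 2) * g i) <= Y `^ (q - 2) * b.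
Proof.
move=> n0 y0 g0 q2 Y0 b0 yY gb.
have q0 : 0 < q by lra.
have q20 : 0 < q - 2 by lra.
have YY z : (y z / Y) `^ q = y z `^ q / Y `^ q.
  by rewrite powRM ?invr_ge0 ?(ltW Y0) ?(ltW b0)// powRV// ltW.
have BB z : (g z / b) `^ (q / 2) = g z `^ (q / 2) / b `^ (q / 2).
  by rewrite powRM ?invr_ge0 ?(ltW Y0) ?(ltW b0)// powRV// ltW.
have H i : y i `^ (q - 2) * g i <= Y `^ (q - 2) * b *
   ((q - 2) / (q * Y `^ q) * y i `^ q
    + 2 / (q * b `^ (q / 2)) * g i `^ (q / 2)).
  have e1 : y i `^ (q - 2) * g i
      = Y `^ (q - 2) * b * ((y i / Y) `^ (q - 2) * (g i / b)).
    rewrite powRM ?invr_ge0 ?(ltW Y0)// powRV ?ltW//.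
    by field; rewrite !gt_eqF ?powR_gt0.
  rewrite e1 ler_wpM2l ?mulr_ge0 ?powR_ge0 ?(ltW b0)//.
  have := @conjugate_powR R ((y i / Y) `^ (q - 2)) (g i / b)
            (q / (q - 2)) (q / 2) (powR_ge0 _ _).
  rewrite -powRrM (_ : (q - 2) * (q / (q - 2)) = q); last first.
    by field; rewrite gt_eqF.
  rewrite YY BB => /(_ (divr_ge0 (g0 _) (ltW b0))) h.
  apply: (le_trans (h _ _ _)); rewrite ?divr_gt0//.
    by field; rewrite !gt_eqF.
  rewrite le_eqVlt; apply/orP; left; apply/eqP.
  by field; rewrite !gt_eqF ?powR_gt0.
apply: (le_trans (le_mean H)).
rewrite meanZ ler_piMr ?mulr_ge0 ?powR_ge0 ?(ltW b0)//.
rewrite meanD !meanZ.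
have Yq : 0 < Y `^ q by rewrite powR_gt0.
have bq : 0 < b `^ (q / 2) by rewrite powR_gt0.
apply: (@le_trans _ _ ((q - 2) / (q * Y `^ q) * Y `^ q
    + 2 / (q * b `^ (q / 2)) * b `^ (q / 2))).
  by rewrite lerD// ler_wpM2l// divr_ge0 ?mulr_ge0 ?ltW//; lra.
by rewrite le_eqVlt; apply/orP; left; apply/eqP; field; rewrite !gt_eqF.
Qed.

(** * Markov chains reversible for the uniform law *)

(** The infinitesimal generator of a Markov chain on 'I_n, off-diagonal entries
    being jump rates; symmetry is detailed balance for the uniform law. *)
Definition symmetric_rates (R : realType) (n : nat) (Q : 'I_n -> 'I_n -> R) :=
  [/\ forall i j, Q i j = Q j i,
      forall i j, i != j -> 0 <= Q i j
    & forall i, \sum_j Q i j = 0].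

Definition rate_op (R : realType) (n : nat) (Q : 'I_n -> 'I_n -> R)
  (f : 'I_n -> R) (i : 'I_n) : R := \sum_j Q i j * f j.

Definition rate_gamma (R : realType) (n : nat) (Q : 'I_n -> 'I_n -> R)
  (f : 'I_n -> R) (i : 'I_n) : R := 2^-1 * \sum_j Q i j * (f j - f i) ^+ 2.

Lemma rate_gamma_ge0 (R : realType) (n : nat) (Q : 'I_n -> 'I_n -> R) f i :
  symmetric_rates Q -> 0 <= rate_gamma Q f i.
Proof.
move=> [_ Q0 _]; rewrite mulr_ge0 ?invr_ge0// sumr_ge0// => j _.
have [->|ij] := eqVneq i j; first by rewrite subrr expr0n mulr0.
by rewrite mulr_ge0 ?sqr_ge0// Q0.
Qed.

(** The diagonal of Q is nonpositive, hence the requirement that F and G agree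
    there. *)
Lemma le_mean_rates (R : realType) (n : nat) (Q F G : 'I_n -> 'I_n -> R) :
    symmetric_rates Q -> (forall i, F i i = G i i) ->
    (forall i j, F i j <= G i j) ->
  mean (fun i => \sum_j Q i j * F i j) <= mean (fun i => \sum_j Q i j * G i j).
Proof.
move=> [_ Q0 _] d FG; apply: le_mean => i; apply: ler_sum => j _.
by have [->|ij] := eqVneq i j; [rewrite d | rewrite ler_wpM2l// Q0].
Qed.

Lemma mean_rates_swap (R : realType) (n : nat) (Q F : 'I_n -> 'I_n -> R) :
    symmetric_rates Q ->
  mean (fun i => \sum_j Q i j * F j i) = mean (fun i => \sum_j Q i j * F i j).
Proof.
move=> [Qs _ _]; rewrite /mean; congr (_ * _); rewrite exchange_big/=.
by apply: eq_bigr => j _; apply: eq_bigr => i _; rewrite Qs.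
Qed.

Lemma mean_rates_left (R : realType) (n : nat) (Q : 'I_n -> 'I_n -> R)
    (h : 'I_n -> R) : symmetric_rates Q ->
  mean (fun i => \sum_j Q i j * h i) = 0.
Proof.
move=> [_ _ Q1]; rewrite /mean big1 ?mulr0// => i _.
by rewrite -mulr_suml Q1 mul0r.
Qed.

(** Expand the product of increments: the two diagonal terms vanish because rows
    and columns of Q sum to 0, the two cross terms coincide by symmetry. *)
Lemma dirichletE (R : realType) (n : nat) (Q : 'I_n -> 'I_n -> R)
    (f g : 'I_n -> R) : symmetric_rates Q ->
  - mean (fun i => g i * rate_op Q f i)
  = 2^-1 * mean (fun i => \sum_j Q i j * ((g i - g j) * (f i - f j))).
Proof.
move=> Qs.
have e1 : mean (fun i => g i * rate_op Q f i)
    = mean (fun i => \sum_j Q i j * (g i * f j)).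
  by apply: eq_mean => i; rewrite mulr_sumr; apply: eq_bigr => j _; ring.
have e2 := mean_rates_swap (fun i j => g i * f j) Qs.
have e3 := mean_rates_left (fun i => g i * f i) Qs.
have e4 := mean_rates_swap (fun i j => g i * f i) Qs.
rewrite e1.
have -> : mean (fun i => \sum_j Q i j * ((g i - g j) * (f i - f j)))
  = (mean (fun i => \sum_j Q i j * (g i * f i))
     + mean (fun i => \sum_j Q i j * (g j * f j)))
    + -1 * (mean (fun i => \sum_j Q i j * (g i * f j))
         + mean (fun i => \sum_j Q i j * (g j * f i))).
  rewrite -!meanD -meanZ -meanD; apply: eq_mean => i.
  rewrite -!big_split/= mulr_sumr -big_split/=.
  by apply: eq_bigr => j _; ring.
by rewrite e2 e4 e3; field.
Qed.

(** Symmetrize in the two indices. *)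
Lemma mean_gammaE (R : realType) (n : nat) (Q : 'I_n -> 'I_n -> R)
    (h f : 'I_n -> R) : symmetric_rates Q ->
  mean (fun i => h i * rate_gamma Q f i)
  = 4^-1 * mean (fun i => \sum_j Q i j * ((h i + h j) * (f i - f j) ^+ 2)).
Proof.
move=> Qs.
have e1 : mean (fun i => h i * rate_gamma Q f i)
    = 2^-1 * mean (fun i => \sum_j Q i j * (h i * (f i - f j) ^+ 2)).
  rewrite -meanZ; apply: eq_mean => i; rewrite /rate_gamma mulrCA.
  by congr (_ * _); rewrite mulr_sumr; apply: eq_bigr => j _; ring.
have e2 := mean_rates_swap (fun i j => h i * (f i - f j) ^+ 2) Qs.
have -> : mean (fun i => \sum_j Q i j * ((h i + h j) * (f i - f j) ^+ 2))
  = mean (fun i => \sum_j Q i j * (h i * (f i - f j) ^+ 2))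
    + mean (fun i => \sum_j Q i j * (h j * (f j - f i) ^+ 2)).
  rewrite -meanD; apply: eq_mean => i; rewrite -big_split/=.
  by apply: eq_bigr => j _; ring.
by rewrite e2 e1; field.
Qed.

(** Both sides are sums over pairs weighted by jump rates, and they compare pair
    by pair.  Allowing y and x to differ, as long as the increments of y are
    dominated, covers both the absolute value and the addition of a constant. *)
Lemma dirichlet_powR_le (R : realType) (n : nat) (Q : 'I_n -> 'I_n -> R)
    (x y : 'I_n -> R) (q : R) :
    symmetric_rates Q -> (forall i, 0 < y i) -> 2 <= q ->
    (forall i j, `|y i - y j| <= `|x i - x j|) ->
  - mean (fun i => y i * rate_op Q (fun j => y j `^ (q - 1)) i)
  <= 2 * (q - 1) * mean (fun i => y i `^ (q - 2) * rate_gamma Q x i).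
Proof.
move=> Qs y0 q2 yx; rewrite dirichletE// mean_gammaE//.
set A := mean _; set B := mean _.
suff : A <= (q - 1) * B by lra.
rewrite -meanZ.
under [leRHS]eq_mean => i.
  rewrite mulr_sumr.
  under eq_bigr => j _ do rewrite mulrCA.
  over.
apply: le_mean_rates => // [i|i j]; first by rewrite !subrr expr0n/=; ring.
apply: (le_trans (two_point (y0 i) (y0 j) q2)).
rewrite [leRHS]mulrCA [leRHS]mulrC -mulrA [(q - 1) * _]mulrC -!mulrA.
rewrite [leLHS](_ : _ = (y i - y j) ^+ 2
   * ((q - 1) * (y i `^ (q - 2) + y j `^ (q - 2)))); last by ring.
rewrite [leRHS](_ : _ = (x i - x j) ^+ 2
   * ((q - 1) * (y i `^ (q - 2) + y j `^ (q - 2)))); last by ring.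
have q10 : 0 <= q - 1 by lra.
rewrite ler_wpM2r//; first by rewrite mulr_ge0// addr_ge0// powR_ge0.
by rewrite -(real_normK (num_real (y i - y j))) -(real_normK (num_real (x i - x j))) lerXn2r ?nnegrE.
Qed.

(** * Moments under Beckner inequalities *)

(** Beckner inequalities restricted to one commutative subalgebra, with the
    constant as a function of the exponent. *)
Definition diagonal_beckner (R : realType) (n : nat) (Q : 'I_n -> 'I_n -> R)
    (c : R -> R) := forall p f, 1 < p -> p <= 2 -> (forall i, 0 < f i) ->
  c p * (p / (p - 1)) * (mean (fun i => f i `^ p) - mean f `^ p)
  <= - (p / (p - 1) * p / 4) * mean (fun i => f i `^ (p - 1) * rate_op Q f i).

(** The exponent q / (q - 1) is chosen so that f = y^(q-1) satisfies f^p = y^q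
    and f^(p-1) = y: the Beckner inequality then compares two consecutive norms
    of y. *)
Lemma beckner_step (R : realType) (n : nat) (Q : 'I_n -> 'I_n -> R)
    (a s : R) (x y : 'I_n -> R) (q b : R) :
    (0 < n)%N -> symmetric_rates Q -> 0 < a -> 0 <= s ->
    diagonal_beckner Q (fun p => a * (p - 1) `^ s) ->
    (forall i, 0 < y i) -> (forall i j, `|y i - y j| <= `|x i - x j|) ->
    2 < q -> 0 < b ->
    mean (fun i => rate_gamma Q x i `^ (q / 2)) <= b `^ (q / 2) ->
  mean (fun i => y i `^ q)
  <= mean (fun i => y i `^ (q - 1)) `^ (q / (q - 1))
     + q `^ (s + 1) / (2 * a)
       * (mean (fun i => y i `^ q) `^ (q^-1) `^ (q - 2) * b).
Proof.
move=> n0 Qs a0 s0 bk y0 yx q2 b0 gb.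
have q0 : 0 < q by lra.
have q10 : 0 < q - 1 by lra.
have := bk (q / (q - 1)) (fun i => y i `^ (q - 1)).
have -> : q / (q - 1) - 1 = (q - 1)^-1 by field; rewrite gt_eqF.
have -> : q / (q - 1) / (q - 1)^-1 = q by field; rewrite gt_eqF.
rewrite ltr_pdivlMr// mul1r ltrBlDr ltrDl ltr01 => /(_ isT).
rewrite ler_pdivrMr// => /(_ _ (fun i => powR_gt0 _ (y0 i))).
have h2 : q <= 2 * (q - 1) by lra.
move=> /(_ h2).
have -> : mean (fun i => (y i `^ (q - 1)) `^ (q / (q - 1)))
    = mean (fun i => y i `^ q).
  apply: eq_mean => i; rewrite -powRrM; congr powR.
  by field; rewrite gt_eqF.
have -> : mean (fun i => (y i `^ (q - 1)) `^ (q - 1)^-1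
                         * rate_op Q (fun i => y i `^ (q - 1)) i)
    = mean (fun i => y i * rate_op Q (fun i => y i `^ (q - 1)) i).
  apply: eq_mean => i; rewrite -powRrM mulfV ?gt_eqF// powRr1// ltW//.
have dl := dirichlet_powR_le Qs y0 (ltW q2) yx.
set A := mean (fun i => y i `^ q); set Z := _ `^ (q / _); set D := mean _ in dl *.
have A0 : 0 < A by apply: mean_gt0 => // i; rewrite powR_gt0.
have hol : mean (fun i => y i `^ (q - 2) * rate_gamma Q x i)
    <= (A `^ q^-1) `^ (q - 2) * b.
  apply: mean_holder => //.
  - by move=> i; rewrite ltW.
  - by move=> i; apply: rate_gamma_ge0.
  - by rewrite powR_gt0.
  - by rewrite -powRrM mulVf ?gt_eqF// powRr1 ?(ltW A0).
set M := mean _ in dl hol; set N := _ * b in hol *.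
rewrite powRV ?(ltW q10)// => bk'.
have P0 : 0 < (q - 1) `^ s by rewrite powR_gt0.
have {bk'} bk2 : A - Z <= (q - 1) `^ s / a * ((q / (q - 1)) / 4 * - D).
  have c0 : 0 < a / (q - 1) `^ s * q by rewrite !mulr_gt0 ?invr_gt0.
  rewrite -(ler_pM2l c0); apply: (le_trans bk').
  by rewrite le_eqVlt; apply/orP; left; apply/eqP; field; rewrite !gt_eqF.
rewrite -lerBlDl; apply: (le_trans bk2).
have N0 : 0 <= N by rewrite mulr_ge0 ?powR_ge0 ?ltW.
apply: (@le_trans _ _ ((q - 1) `^ s / a * (q / (q - 1) / 4 * (2 * (q - 1) * N)))).
  rewrite ler_wpM2l ?divr_ge0 ?(ltW P0) ?(ltW a0)//.
  rewrite ler_wpM2l ?divr_ge0 ?(ltW q0) ?(ltW q10)//.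
  apply: (le_trans dl); rewrite ler_wpM2l//; lra.
have -> : (q - 1) `^ s / a * (q / (q - 1) / 4 * (2 * (q - 1) * N))
   = q * (q - 1) `^ s / (2 * a) * N by field; rewrite !gt_eqF.
rewrite ler_wpM2r// ler_wpM2r ?invr_ge0 ?mulr_ge0 ?(ltW a0)//.
rewrite (@powRD _ q s 1) ?(gt_eqF q0) ?implybT// powRr1 ?(ltW q0)// mulrC ler_wpM2r ?(ltW q0)//.
by rewrite ge0_ler_powR ?nnegrE//; lra.
Qed.

Lemma kappa_gt0 (R : realType) (s : R) : 0 <= s -> 0 < kappa s.
Proof.
move=> s0; rewrite invr_gt0 subr_gt0 expR_lt1 oppr_lt0.
by apply: divr_gt0 => //; lra.
Qed.

Lemma kappa_ge1 (R : realType) (s : R) : 0 <= s -> 1 <= kappa s.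
Proof.
move=> s0; have := kappa_gt0 s0; rewrite /kappa invr_gt0 => h.
by rewrite -[leLHS]invr1 lef_pV2 ?posrE// gerBl expR_ge0.
Qed.

(** By contradiction: if Y exceeded the bound, then the term in Z would be at most
    exp(-(s+1)/2) Y^q, and the other term less than Y^q / kappa s; the two
    coefficients add up to 1. *)
Lemma moment_absorb (R : realType) (s q B Y Z : R) : 0 <= s -> 2 < q ->
    0 < B -> 0 < Y -> 0 <= Z ->
    Z ^+ 2 <= (q - 1) `^ (s + 1) * kappa s * B ->
    Y `^ q <= Z `^ q + q `^ (s + 1) * B * Y `^ (q - 2) ->
  Y ^+ 2 <= q `^ (s + 1) * kappa s * B.
Proof.
move=> s0 q2 b0 Y0 Z0 hZ hY; rewrite leNgt; apply/negP => lt.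
have q0 : 0 < q by lra.
have k0 := kappa_gt0 s0.
have qs : 0 < q `^ (s + 1) by rewrite powR_gt0.
have YY : Y `^ q = Y ^+ 2 * Y `^ (q - 2).
  by rewrite -powR_mulrn ?(ltW Y0)// -powRD ?(gt_eqF Y0) ?implybT//; congr powR; ring.
have Yq2 : 0 < Y `^ (q - 2) by rewrite powR_gt0.
have Yq : 0 < Y `^ q by rewrite powR_gt0.
have t2 : q `^ (s + 1) * B * Y `^ (q - 2) < (1 - expR (- ((s + 1) / 2))) * Y `^ q.
  have -> : 1 - expR (- ((s + 1) / 2)) = (kappa s)^-1 by rewrite /kappa invrK.
  by rewrite YY mulrA ltr_pM2r// ltr_pdivlMl// mulrA [kappa s * _]mulrC.
have t1 : Z `^ q <= expR (- ((s + 1) / 2)) * Y `^ q.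
  have ZE : Z `^ q = (Z ^+ 2) `^ (q / 2).
    by rewrite -powR_mulrn// -powRrM; congr powR; field.
  have YE : Y `^ q = (Y ^+ 2) `^ (q / 2).
    by rewrite -powR_mulrn ?(ltW Y0)// -powRrM; congr powR; field.
  (* (1 - 1/q) <= exp (- 1/q), to the power s + 1. *)
  have e1 : (q - 1) `^ (s + 1) <= expR (- ((s + 1) / q)) * q `^ (s + 1).
    have -> : q - 1 = (1 + - q^-1) * q by field; rewrite gt_eqF.
    have qi : q^-1 <= 1 by rewrite invf_le1//; lra.
    rewrite powRM ?(ltW q0)//; last by rewrite subr_ge0.
    rewrite ler_wpM2r ?(ltW qs)//.
    apply: (@le_trans _ _ (expR (- q^-1) `^ (s + 1))).
      rewrite ge0_ler_powR ?nnegrE ?expR_ge0 ?expR_ge1Dx//; first lra.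
      by rewrite subr_ge0.
    rewrite -expRM le_eqVlt; apply/orP; left; apply/eqP; congr expR.
    by field; rewrite gt_eqF.
  have e2 : Z ^+ 2 <= expR (- ((s + 1) / q)) * Y ^+ 2.
    apply: (le_trans hZ); apply: (@le_trans _ _
      (expR (- ((s + 1) / q)) * (q `^ (s + 1) * kappa s * B))).
      by rewrite !mulrA ler_pM2r// ler_pM2r.
    by rewrite ler_wpM2l ?expR_ge0// ltW.
  rewrite ZE; apply: (@le_trans _ _ ((expR (- ((s + 1) / q)) * Y ^+ 2) `^ (q / 2))).
    rewrite ge0_ler_powR ?nnegrE ?sqr_ge0 ?mulr_ge0 ?expR_ge0 ?(ltW q0) ?(ltW Y0)//.
  rewrite powRM ?expR_ge0 ?sqr_ge0// -YE ler_pM2r//.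
  rewrite -expRM le_eqVlt; apply/orP; left; apply/eqP; congr expR.
  by field; rewrite gt_eqF.
move: hY t1 t2; set E := expR _; lra.
Qed.

(** Here A and D stand for the moments of orders q and q - 1, so the norms of the
    previous lemma are Y = A^(1/q) and Z = D^(1/(q-1)). *)
Lemma moment_step (R : realType) (s q a B A D : R) : 0 <= s -> 2 < q ->
    0 < a -> 0 < B -> 0 < A -> 0 <= D ->
    (D `^ (q - 1)^-1) ^+ 2 <= (q - 1) `^ (s + 1) * kappa s * B ->
    A <= D `^ (q / (q - 1))
         + q `^ (s + 1) / (2 * a) * (A `^ q^-1 `^ (q - 2) * (2 * a * B)) ->
  (A `^ q^-1) ^+ 2 <= q `^ (s + 1) * kappa s * B.
Proof.
move=> s0 q2 a0 B0 A0 D0 hD hA.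
have q0 : 0 < q by lra.
apply: (moment_absorb s0 q2 B0 (powR_gt0 _ A0) (powR_ge0 _ _) hD).
have -> : (A `^ q^-1) `^ q = A by rewrite -powRrM mulVf ?gt_eqF// powRr1 ?ltW.
rewrite -powRrM [(q - 1)^-1 * q]mulrC; apply: (le_trans hA).
rewrite lerD2l le_eqVlt; apply/orP; left; apply/eqP.
by field; rewrite gt_eqF.
Qed.

(** The variance does not see the constant c, which will serve to make x + c
    positive. *)
Lemma mean_variance (R : realType) (n : nat) (x : 'I_n -> R) (c : R) :
    (0 < n)%N ->
  mean (fun i => (x i + c) ^+ 2) - mean (fun i => x i + c) ^+ 2
  = mean (fun i => (x i - mean x) ^+ 2).
Proof.
move=> n0; set m := mean x.
have -> : mean (fun i => (x i - m) ^+ 2)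
    = mean (fun i => x i ^+ 2) + (- (2 * m)) * m + m ^+ 2.
  rewrite -{3}/m -meanZ -(mean_cst (m ^+ 2) n0) -!meanD.
  by apply: eq_mean => i; ring.
have -> : mean (fun i => (x i + c) ^+ 2)
    = mean (fun i => x i ^+ 2) + (2 * c) * m + c ^+ 2.
  rewrite -meanZ -(mean_cst (c ^+ 2) n0) -!meanD.
  by apply: eq_mean => i; ring.
by rewrite meanD mean_cst// -/m; ring.
Qed.

(** The Beckner inequality of exponent 2 for x + c with c large: its left-hand
    side is a variance and its right-hand side a mean of gamma. *)
Lemma spectral_gap (R : realType) (n : nat) (Q : 'I_n -> 'I_n -> R)
    (a s : R) (x : 'I_n -> R) :
    (0 < n)%N -> symmetric_rates Q -> 0 < a ->
    diagonal_beckner Q (fun p => a * (p - 1) `^ s) ->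
  mean (fun i => (x i - mean x) ^+ 2) <= mean (rate_gamma Q x) / (2 * a).
Proof.
move=> n0 Qs a0 bk; set c := 1 + \sum_i `|x i|.
have f0 i : 0 < x i + c.
  have : - x i <= \sum_i `|x i|.
    apply: (@le_trans _ _ `|x i|); first by rewrite -normrN ler_norm.
    by rewrite (bigD1 i)//= lerDl sumr_ge0.
  by rewrite /c; lra.
have := bk 2 (fun i => x i + c) _ (lexx _) f0.
rewrite (_ : 2 - 1 = 1); last by ring.
rewrite powR1 ltr1n => /(_ isT).
have -> : mean (fun i => (x i + c) `^ 2) = mean (fun i => (x i + c) ^+ 2).
  by apply: eq_mean => i; rewrite powR_mulrn// ltW.
rewrite powR_mulrn; last by apply: mean_ge0 => i; rewrite ltW.
rewrite mean_variance//.
have -> : - (2 / 1 * 2 / 4) = -1 :> R by field.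
rewrite mulN1r.
have -> : mean (fun i => (x i + c) `^ 1 * rate_op Q (fun i => x i + c) i)
    = mean (fun i => (x i + c) * rate_op Q (fun i => x i + c) i).
  by apply: eq_mean => i; rewrite powRr1// ltW.
rewrite dirichletE//.
have := mean_gammaE (fun=> 1) x Qs.
have -> : mean (fun i => 1 * rate_gamma Q x i) = mean (rate_gamma Q x).
  by apply: eq_mean => i; rewrite mul1r.
move=> ->.
have -> : mean (fun i => \sum_j Q i j * ((1 + 1) * (x i - x j) ^+ 2))
  = 2 * mean (fun i => \sum_j Q i j * ((x i + c - (x j + c)) * (x i + c - (x j + c)))).
  rewrite -meanZ; apply: eq_mean => i; rewrite mulr_sumr.
  by apply: eq_bigr => j _; ring.
rewrite mulr1 divr1 => h; rewrite ler_pdivlMr ?mulr_gt0//; move: h.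
set A := mean _; set B := mean _; lra.
Qed.

(** A perturbation that makes the vector positive at the expense of a small
    increase of its second moment. *)
Lemma mean_norm_shift (R : realType) (n : nat) (z : 'I_n -> R) (e : R) :
    (0 < n)%N -> 0 < e -> exists2 d, 0 < d &
  mean (fun i => (`|z i| + d) ^+ 2) <= mean (fun i => z i ^+ 2) + e.
Proof.
move=> n0 e0; set m := mean (fun i => `|z i|).
have m0 : 0 <= m by apply: mean_ge0.
have D0 : 0 < 2 * m + 1 + e by lra.
(* Any d <= 1 with d (2 m + 1) <= e is suitable. *)
exists (e / (2 * m + 1 + e)); first by rewrite divr_gt0.
set d := e / _.
have d0 : 0 < d by rewrite divr_gt0.
have d1 : d <= 1 by rewrite ler_pdivrMr// mul1r; lra.
have de : d * (2 * m + 1) <= e.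
  rewrite mulrAC ler_pdivrMr// ler_pM2l//; lra.
have -> : mean (fun i => (`|z i| + d) ^+ 2)
    = mean (fun i => z i ^+ 2) + (2 * d * m + d ^+ 2).
  rewrite -meanZ -(mean_cst (d ^+ 2) n0) -!meanD.
  by apply: eq_mean => i; rewrite -(real_normK (num_real (z i))); ring.
rewrite lerD2l; apply: le_trans de.
rewrite (_ : d * (2 * m + 1) = 2 * d * m + d); last by ring.
by rewrite lerD2l expr2 ler_piMr// ltW.
Qed.

(** The bound B must dominate both the second moment, to start the induction on
    [1, 2], and the norm of gamma divided by 2 a, to perform its steps. *)
Lemma moment_bound_pos (R : realType) (n : nat) (Q : 'I_n -> 'I_n -> R)
    (a s r B : R) (x y : 'I_n -> R) :
    (0 < n)%N -> symmetric_rates Q -> 0 < a -> 0 <= s ->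
    diagonal_beckner Q (fun p => a * (p - 1) `^ s) ->
    (forall i, 0 < y i) -> (forall i j, `|y i - y j| <= `|x i - x j|) ->
    0 < B -> mean (fun i => y i ^+ 2) <= B ->
    mean (fun i => rate_gamma Q x i `^ (r / 2)) <= (2 * a * B) `^ (r / 2) ->
  forall (k : nat) (q : R), 1 <= q -> q <= k%:R + 2 -> q <= r ->
    (mean (fun i => y i `^ q) `^ q^-1) ^+ 2 <= q `^ (s + 1) * kappa s * B.
Proof.
move=> n0 Qs a0 s0 bk y0 yx B0 yB gB.
have base (q : R) : 1 <= q -> q <= 2 ->
    (mean (fun i => y i `^ q) `^ q^-1) ^+ 2 <= q `^ (s + 1) * kappa s * B.
  move=> q1 q2; have q0 : 0 < q by lra.
  have sB : 0 <= Num.sqrt B by rewrite sqrtr_ge0.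
  have : mean (fun i => y i `^ q) <= Num.sqrt B `^ q.
    apply: mean_powR_mono q2 _ _ => //; first by move=> i; rewrite ltW.
    rewrite powR_mulrn// sqr_sqrtr ?(ltW B0)//.
    by rewrite (eq_mean (fun i => powR_mulrn 2 (ltW (y0 i)))).
  move=> h; apply: (@le_trans _ _ B); last first.
    rewrite ler_peMl ?(ltW B0)//.
    rewrite -[leLHS]mulr1 ler_pM ?ler01 ?kappa_ge1//.
    apply: (@le_trans _ _ (1 `^ (s + 1))); first by rewrite powR1.
    rewrite ge0_ler_powR ?nnegrE//; lra.
  rewrite -[leRHS](sqr_sqrtr (ltW B0)) lerXn2r ?nnegrE ?powR_ge0//.
  rewrite -[leRHS](powRr1 sB) -(mulfV (lt0r_neq0 q0)) powRrM.
  rewrite ge0_ler_powR ?nnegrE ?powR_ge0 ?invr_ge0 ?(ltW q0)//.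
  by apply: mean_ge0 => i; rewrite powR_ge0.
elim => [|k IH] q q1 qk qr.
  by apply: base => //; lra.
have [q2|q2] := leP q 2; first exact: base.
have q0 : 0 < q by lra.
have q10 : 0 < q - 1 by lra.
have mq t : 0 < mean (fun i => y i `^ t) by apply: mean_gt0 => // i; rewrite powR_gt0.
have b0 : 0 < 2 * a * B by rewrite !mulr_gt0.
have gq : mean (fun i => rate_gamma Q x i `^ (q / 2)) <= (2 * a * B) `^ (q / 2).
  have q20 : 0 < q / 2 by rewrite divr_gt0.
  have qr2 : q / 2 <= r / 2 by rewrite ler_pM2r ?invr_gt0.
  exact: (mean_powR_mono n0 (fun i => rate_gamma_ge0 x i Qs) q20 qr2 (ltW b0) gB).
have prev : (mean (fun i => y i `^ (q - 1)) `^ (q - 1)^-1) ^+ 2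
    <= (q - 1) `^ (s + 1) * kappa s * B.
  apply: IH; first by rewrite lerBrDr (le_trans _ (ltW q2)).
    by rewrite lerBlDr addrAC natr1.
  by apply: le_trans qr; rewrite gerBl.
exact: (moment_step s0 q2 a0 B0 (mq q) (ltW (mq (q - 1))) prev
  (beckner_step n0 Qs a0 s0 bk y0 yx q2 b0 gq)).
Qed.

(** Apply the bound for positive vectors to |x - mean x| + delta, with B slightly
    above G / (2 a), and let B decrease to that value. *)
Lemma moment_bound (R : realType) (n : nat) (Q : 'I_n -> 'I_n -> R)
    (a s r G : R) (x : 'I_n -> R) :
    (0 < n)%N -> symmetric_rates Q -> 0 < a -> 0 <= s -> 2 <= r -> 0 <= G ->
    diagonal_beckner Q (fun p => a * (p - 1) `^ s) ->
    mean (fun i => rate_gamma Q x i `^ (r / 2)) <= G `^ (r / 2) ->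
  (mean (fun i => `|x i - mean x| `^ r) `^ r^-1) ^+ 2
    <= r `^ (s + 1) * kappa s / (2 * a) * G.
Proof.
move=> n0 Qs a0 s0 r2 G0 bk gG.
have g0 i : 0 <= rate_gamma Q x i by apply: rate_gamma_ge0.
have r0 : 0 < r by lra.
have gap : mean (fun i => (x i - mean x) ^+ 2) <= G / (2 * a).
  apply: (le_trans (spectral_gap x n0 Qs a0 bk)).
  rewrite ler_wpM2r ?invr_ge0 ?mulr_ge0 ?(ltW a0)//.
  have := @mean_powR_mono _ _ _ 1 (r / 2) G n0 g0 ltr01 _ G0 gG.
  rewrite powRr1// (eq_mean (fun i => powRr1 (g0 i))).
  by apply; lra.
have c0 : 0 < r `^ (s + 1) * kappa s by rewrite mulr_gt0 ?powR_gt0 ?kappa_gt0.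
apply/ler_addgt0Pr => e e0.
set h := e / (r `^ (s + 1) * kappa s).
have h0 : 0 < h by rewrite divr_gt0.
have [d d0 hd] := mean_norm_shift (fun i => x i - mean x) n0 h0.
have GB : 0 <= G / (2 * a) by rewrite divr_ge0 ?mulr_ge0 ?(ltW a0).
have B0 : 0 < G / (2 * a) + h by lra.
(* Enough induction steps to reach r. *)
have rk : r <= (Num.truncn r).+1%:R + 2.
  by have := truncnS_gt r; lra.
have := @moment_bound_pos R n Q a s r (G / (2 * a) + h) x
  (fun i => `|x i - mean x| + d) n0 Qs a0 s0 bk _ _ B0 _ _ _ r _ rk (lexx _).
move=> H; apply: (le_trans (le_trans _ (H _ _ _ _ _))).
- apply: lerXn2r; [exact: powR_ge0|exact: powR_ge0|].
  apply: ge0_ler_powR.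
  + by rewrite invr_ge0 ltW.
  + by apply: mean_ge0 => i; exact: powR_ge0.
  + by apply: mean_ge0 => i; exact: powR_ge0.
  apply: le_mean => i; rewrite ge0_ler_powR ?nnegrE ?(ltW r0)//.
    by rewrite addr_ge0// ltW.
  by rewrite lerDl ltW.
- by move=> i; rewrite ltr_wpDl.
- move=> i j; rewrite opprD addrACA subrr addr0.
  apply: (le_trans (ler_dist_dist _ _)).
  by rewrite (_ : x i - mean x - (x j - mean x) = x i - x j)//; ring.
- by apply: (le_trans hd); rewrite lerD2r.
- apply: (le_trans gG); rewrite ge0_ler_powR ?nnegrE//; first by lra.
    by rewrite mulr_ge0 ?mulr_ge0// ltW.
  have -> : 2 * a * (G / (2 * a) + h) = G + 2 * a * h.
    by field; rewrite gt_eqF.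
  by rewrite lerDl ltW// (mulr_gt0 _ h0)// mulr_gt0.
- by lra.
rewrite le_eqVlt; apply/orP; left; apply/eqP; rewrite /h.
by field; rewrite !gt_eqF ?kappa_gt0 ?powR_gt0.
Qed.

(** * Operators diagonal in an orthonormal basis *)

Local Notation Re := complex.Re.
Local Notation Im := complex.Im.

Lemma conj_real (R : realType) (x : R) : Num.conj (x%:C : C R) = x%:C.
Proof. exact: conjc_real. Qed.

Lemma real_complex_ge0 (R : realType) (x : R) : 0 <= x -> 0 <= (x%:C : C R).
Proof. by move=> h; exact: etrans (ler0c x) h. Qed.

Lemma real_complex_gt0 (R : realType) (x : R) : 0 < x -> 0 < (x%:C : C R).
Proof. by move=> h; exact: etrans (ltcR 0 x) h. Qed.

Lemma Re_conj (R : realType) (z : C R) : Re (Num.conj z) = Re z.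
Proof. by case: z. Qed.

Lemma ReZ (R : realType) (x : R) (z : C R) : Re (x%:C * z) = x * Re z.
Proof. by case: z => a b /=; rewrite mul0r subr0. Qed.

Lemma ReD (R : realType) (x y : C R) : Re (x + y) = Re x + Re y.
Proof. by case: x y => a b []. Qed.

Lemma ReN (R : realType) (x : C R) : Re (- x) = - Re x.
Proof. by case: x. Qed.

Lemma Re_sum (R : realType) (I : finType) (F : I -> C R) :
  Re (\sum_i F i) = \sum_i Re (F i).
Proof. by apply: (big_morph (@complex.Re R)) => // x y; rewrite ReD. Qed.

(** The operator with eigenvalues x in the orthonormal basis formed by the
    columns of the adjoint of U. *)
Definition diag_in (R : realType) (n : nat) (U : 'B[R]_n) (x : 'I_n -> R) :
    'B[R]_n :=
  U^t* *m diag_mx (\row_i ((x i)%:C : C R)) *m U.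

Lemma unitary_mul (R : realType) (n : nat) (U : 'B[R]_n) :
  U \is unitarymx -> U *m U^t* = 1%:M.
Proof. by move/unitarymxP. Qed.

Lemma unitary_mulC (R : realType) (n : nat) (U : 'B[R]_n) :
  U \is unitarymx -> U^t* *m U = 1%:M.
Proof. by move/unitary_mul/mulmx1C. Qed.

Lemma adjM (R : realType) (m n p : nat) (A : 'M[C R]_(m, n)) (B : 'M[C R]_(n, p)) :
  (A *m B)^t* = B^t* *m A^t*.
Proof. by rewrite trmx_mul map_mxM. Qed.

Lemma adjB (R : realType) (m n : nat) (A B : 'M[C R]_(m, n)) :
  (A - B)^t* = A^t* - B^t*.
Proof. by apply/matrixP => i j; rewrite !mxE rmorphB. Qed.

Lemma hermE (R : realType) (n : nat) (A : 'B[R]_n) :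
  (A \is hermsymmx) = (A^t* == A).
Proof. by rewrite qualifE /= expr0 scale1r eq_sym. Qed.

Lemma diag_in_adj (R : realType) (n : nat) (U : 'B[R]_n) (x : 'I_n -> R) :
  (diag_in U x)^t* = diag_in U x.
Proof.
rewrite /diag_in !adjM trmxCK mulmxA tr_diag_mx map_diag_mx.
congr (_ *m diag_mx _ *m _).
by apply/rowP => i; rewrite !mxE; exact: conj_real.
Qed.

Lemma diag_in_herm (R : realType) (n : nat) (U : 'B[R]_n) (x : 'I_n -> R) :
  diag_in U x \is hermsymmx.
Proof. by rewrite hermE diag_in_adj. Qed.

Lemma diag_inM (R : realType) (n : nat) (U : 'B[R]_n) (x y : 'I_n -> R) :
  U \is unitarymx -> diag_in U x *m diag_in U y = diag_in U (fun i => x i * y i).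
Proof.
move=> Uu; rewrite /diag_in -!mulmxA [U *m _]mulmxA (unitary_mul Uu) mul1mx.
congr (_ *m _); rewrite !mulmxA mulmx_diag; congr (diag_mx _ *m _).
by apply/rowP => i; rewrite !mxE rmorphM.
Qed.

Lemma diag_in_cst (R : realType) (n : nat) (U : 'B[R]_n) (c : R) :
  U \is unitarymx -> diag_in U (fun=> c) = (c%:C : C R)%:M.
Proof.
move=> Uu; rewrite /diag_in (_ : diag_mx _ = (c%:C : C R)%:M).
  by rewrite mul_mx_scalar -scalemxAl unitary_mulC// scalemx1.
by apply/matrixP => i j; rewrite !mxE.
Qed.

Lemma diag_inB (R : realType) (n : nat) (U : 'B[R]_n) (x y : 'I_n -> R) :
  diag_in U x - diag_in U y = diag_in U (fun i => x i - y i).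
Proof.
rewrite /diag_in -mulmxBl -mulmxBr -raddfB; congr (_ *m diag_mx _ *m _).
by apply/rowP => i; rewrite !mxE rmorphB.
Qed.

Lemma diag_in_sum (R : realType) (n : nat) (U : 'B[R]_n) (x : 'I_n -> R) :
  diag_in U x
  = \sum_j ((x j)%:C : C R) *: diag_in U (fun i => (i == j)%:R).
Proof.
rewrite /diag_in.
under eq_bigr do rewrite scalemxAl scalemxAr -linearZ/=.
rewrite -mulmx_suml -mulmx_sumr -raddf_sum; congr (_ *m diag_mx _ *m _).
apply/rowP => i; rewrite summxE (bigD1 i)//= !mxE eqxx mulr1.
rewrite big1 ?addr0// => j ji; rewrite !mxE eq_sym (negbTE ji) mulr0//.
Qed.

Lemma diag_in_quad (R : realType) (n : nat) (U : 'B[R]_n) (x : 'I_n -> R)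
    (v : 'cV[C R]_n) :
  (v^t* *m diag_in U x *m v) 0 0
  = \sum_i ((x i)%:C : C R) * `|(U *m v) i 0| ^+ 2.
Proof.
have -> : v^t* *m diag_in U x *m v
  = (U *m v)^t* *m (diag_mx (\row_i ((x i)%:C : C R)) *m (U *m v)).
  by rewrite adjM /diag_in !mulmxA.
rewrite mxE; apply: eq_bigr => i _; rewrite mul_diag_mx !mxE.
by rewrite normCKC mulrCA.
Qed.

Lemma diag_in_psd (R : realType) (n : nat) (U : 'B[R]_n) (x : 'I_n -> R) :
  (forall i, 0 <= x i) -> psdmx (diag_in U x).
Proof.
move=> x0; split; first exact: diag_in_herm.
move=> v; rewrite diag_in_quad sumr_ge0// => i _.
by apply: mulr_ge0; [exact: real_complex_ge0 | exact: exprn_ge0].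
Qed.

Lemma diag_in_pd (R : realType) (n : nat) (U : 'B[R]_n) (x : 'I_n -> R) :
  U \is unitarymx -> (forall i, 0 < x i) -> pdmx (diag_in U x).
Proof.
move=> Uu x0; split; first exact: diag_in_herm.
move=> v v0; rewrite diag_in_quad.
have t0 i : 0 <= ((x i)%:C : C R) * `|(U *m v) i 0| ^+ 2.
  by apply: mulr_ge0; [exact/real_complex_ge0/ltW | exact: exprn_ge0].
(* U is invertible, so U v has a nonzero coordinate. *)
have [i i0] : exists i, (U *m v) i 0 != 0.
  apply: contrapT => H; case/eqP: v0.
  rewrite -[v]mul1mx -(unitary_mulC Uu) -mulmxA.
  rewrite (_ : U *m v = 0) ?mulmx0//; apply/colP => i; rewrite [RHS]mxE.
  by have [->|h] := eqVneq ((U *m v) i 0) 0; [|case: H; exists i].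
rewrite (bigD1 i)//= ltr_wpDr ?sumr_ge0//; apply: mulr_gt0.
  exact: real_complex_gt0.
by rewrite exprn_gt0// normr_gt0.
Qed.

Lemma diag_in_exists (R : realType) (n : nat) (A : 'B[R]_n) :
  A \is hermsymmx ->
  A = diag_in (spectralmx A) (fun i => Re (spectral_diag A 0 i)).
Proof.
move=> Ah; have /orthomx_spectralP := hermitian_normalmx Ah.
rewrite (invmx_unitary (spectral_unitarymx A)) => {1}->.
rewrite /diag_in; congr (_ *m diag_mx _ *m _).
apply/rowP => i; rewrite mxE RRe_real//.
by have /mxOverP := hermitian_spectral_diag_real Ah; apply.
Qed.

(** The functional calculus is defined by one chosen diagonalization; this says
    that any other gives the same result.  The change of basis W between the two
    intertwines the eigenvalues, so each nonzero entry of W links equal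
    eigenvalues, and W intertwines their images under f as well. *)
Lemma funmx_diag_in (R : realType) (n : nat) (f : R -> R) (U : 'B[R]_n)
    (x : 'I_n -> R) : U \is unitarymx ->
  funmx f (diag_in U x) = diag_in U (f \o x).
Proof.
move=> Uu; set A := diag_in U x.
have AE := diag_in_exists (diag_in_herm U x).
rewrite -/A in AE; set V := spectralmx A in AE.
set y := (fun i => _) in AE.
have Vu : V \is unitarymx by apply: spectral_unitarymx.
have -> : funmx f A = diag_in V (f \o y).
  rewrite /funmx -/V (invmx_unitary Vu) /diag_in; congr (_ *m diag_mx _ *m _).
  by apply/rowP => i; rewrite !mxE.
have [W WE] : exists W, W = V *m U^t* by exists (V *m U^t*).
(* Both diagonalizations agree iff W intertwines the two diagonal matrices. *)
have inter (g : R -> R) : diag_in V (g \o y) = diag_in U (g \o x) <->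
    forall i j, ((g (y i))%:C : C R) * W i j = W i j * (g (x j))%:C.
  have eW : diag_in V (g \o y) = diag_in U (g \o x) <->
    diag_mx (\row_i ((g (y i))%:C : C R)) *m W
      = W *m diag_mx (\row_i ((g (x i))%:C : C R)).
    rewrite /diag_in WE; split => [e|e].
      have := congr1 (fun M => V *m M *m U^t*) e.
      rewrite !mulmxA (unitary_mul Vu) mul1mx => ->.
      by rewrite -!mulmxA (unitary_mul Uu) mulmx1.
    have := congr1 (fun M => V^t* *m M *m U) e.
    rewrite !mulmxA (unitary_mulC Vu) mul1mx => <-.
    by rewrite -!mulmxA (unitary_mulC Uu) mulmx1.
  rewrite eW; split => [/matrixP e i j|e].
    by have := e i j; rewrite mul_diag_mx mul_mx_diag !mxE.
  by apply/matrixP => i j; rewrite mul_diag_mx mul_mx_diag !mxE; exact: e.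
apply/inter => i j.
have /(inter id) /(_ i j) /= e : diag_in V (id \o y) = diag_in U (id \o x) by [].
have [->|w0] := eqVneq (W i j) 0; first by rewrite mulr0 mul0r.
move: e; rewrite mulrC => /(mulfI w0) [->]; exact: mulrC.
Qed.

Lemma tr_diag_in_mul (R : realType) (n : nat) (U : 'B[R]_n) (x : 'I_n -> R)
    (M : 'B[R]_n) :
  \tr (diag_in U x *m M) = \sum_i ((x i)%:C : C R) * (U *m M *m U^t*) i i.
Proof.
rewrite /diag_in -!mulmxA mxtrace_mulC -!mulmxA.
by apply: eq_bigr => i _; rewrite mul_diag_mx !mxE.
Qed.

(** The real part of <i| M |i> for the i-th vector of the basis given by U. *)
Definition diag_entry (R : realType) (n : nat) (U M : 'B[R]_n) (i : 'I_n) : R :=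
  Re ((U *m M *m U^t*) i i).

Lemma ntr_diag_in_mul (R : realType) (n : nat) (U : 'B[R]_n) (x : 'I_n -> R)
    (M : 'B[R]_n) :
  ntr (diag_in U x *m M) = mean (fun i => x i * diag_entry U M i).
Proof.
rewrite /ntr tr_diag_in_mul Re_sum; congr (_ * _).
by apply: eq_bigr => i _; rewrite ReZ.
Qed.

Lemma ntr_diag_in (R : realType) (n : nat) (U : 'B[R]_n) (x : 'I_n -> R) :
  U \is unitarymx -> ntr (diag_in U x) = mean x.
Proof.
move=> Uu; rewrite -[diag_in U x]mulmx1 ntr_diag_in_mul; apply: eq_mean => i.
by rewrite /diag_entry mulmx1 unitary_mul// mxE eqxx mulr1.
Qed.

Lemma absmx_diag_in (R : realType) (n : nat) (U : 'B[R]_n) (x : 'I_n -> R) :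
  U \is unitarymx -> absmx (diag_in U x) = diag_in U (fun i => `|x i|).
Proof.
move=> Uu; rewrite /absmx diag_in_adj (diag_inM _ _ Uu) (funmx_diag_in _ _ Uu).
congr diag_in; apply/funext => i /=; exact: sqrtr_sqr.
Qed.

Lemma nschatten_diag_in (R : realType) (n : nat) (U : 'B[R]_n) (x : 'I_n -> R)
    (p : R) : U \is unitarymx ->
  nschatten p (diag_in U x) = mean (fun i => `|x i| `^ p) `^ p^-1.
Proof.
by move=> Uu; rewrite /nschatten (absmx_diag_in _ Uu) /powmx (funmx_diag_in _ _ Uu) (ntr_diag_in _ Uu).
Qed.

(** * Positivity, and limits at time 0 *)

(** For k = 1, complete positivity is about 1 x 1 block matrices, whose size is
    the sum of one term rather than n itself. *)
Lemma psd_block1 (R : realType) (n : nat) (A : 'B[R]_n) :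
  psdmx (\mxblock_(i < 1, j < 1) A) <-> psdmx A.
Proof.
have adjE : (\mxblock_(i < 1, j < 1) A)^t* = \mxblock_(i < 1, j < 1) A^t*.
  by rewrite tr_mxblock; apply/matrixP => i j; rewrite !mxE.
have hermE1 : (\mxblock_(i < 1, j < 1) A \is hermsymmx) = (A \is hermsymmx).
  rewrite !hermE adjE; apply/eqP/eqP => [/eq_mxblockP /(_ ord0 ord0)//|->//].
have quad (v : 'cV[C R]_n) : let w := \mxcol_(i < 1) v in
    w^t* *m \mxblock_(i < 1, j < 1) A *m w = v^t* *m A *m v.
  move=> w; have -> : w^t* = \mxrow_(i < 1) v^t*.
    by rewrite tr_mxcol; apply/matrixP => i j; rewrite !mxE.
  by rewrite /w mul_mxrow_mxblock mul_mxrow_mxcol !big_ord1.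
split => -[h q]; split; rewrite ?hermE1// -?hermE1// => v.
  by rewrite -quad.
have -> : v = \mxcol_(i < 1) submxcol v ord0.
  rewrite -[LHS](@submxcolK _ 1 (fun=> n) 1 v).
  by apply: eq_mxcol => i; rewrite (ord1 i).
by rewrite quad.
Qed.

Lemma completely_positive_psd (R : realType) (n : nat)
    (Phi : 'B[R]_n -> 'B[R]_n) (A : 'B[R]_n) :
  completely_positive Phi -> psdmx A -> psdmx (Phi A).
Proof.
by move=> cp /psd_block1 pA; apply/psd_block1; exact: (cp 1%N (fun _ _ => A)).
Qed.

Lemma diag_entry_psd (R : realType) (n : nat) (U M : 'B[R]_n) (i : 'I_n) :
  psdmx M -> 0 <= diag_entry U M i.
Proof.
move=> [_ /(_ (U^t* *m delta_mx i 0))]; rewrite adjM trmxCK.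
have -> : ((delta_mx i 0 : 'cV[C R]_n)^t* = delta_mx 0 i).
  by apply/matrixP => k l; rewrite !mxE rmorph_nat andbC.
rewrite (_ : _ *m M *m _ = delta_mx 0 i *m (U *m M *m U^t*) *m delta_mx i 0);
  last by rewrite !mulmxA.
by rewrite -rowE -colE mxE mxE lecE => /andP[].
Qed.

Lemma cvg_Re (R : realType) (F : set_system R) (f : R -> C R) (l : C R) :
  Filter F -> f @ F --> l -> (fun t => Re (f t)) @ F --> Re l.
Proof.
move=> FF /cvgrPdist_lt h; apply/cvgrPdist_lt => e e0.
have e0' : 0 < (e%:C : C R) by exact: real_complex_gt0.
apply: filterS (h _ e0') => t lt.
have := le_lt_trans (normc_ge_Re (l - f t)) lt.
by rewrite ltcR; case: (l) (f t) => ? ? [].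
Qed.

Lemma cvg_entry_sandwich (R : realType) (n : nat) (F : set_system R)
    (M : R -> 'B[R]_n) (L A B : 'B[R]_n) (i j : 'I_n) :
  Filter F -> M @ F --> L ->
  (fun t => (A *m M t *m B) i j) @ F --> (A *m L *m B) i j.
Proof.
move=> FF ML.
have E (N : 'B[R]_n) : (A *m N *m B) i j
    = \sum_k \sum_l (A i l * N l k) * B k j.
  by rewrite mxE; apply: eq_bigr => k _; rewrite mxE mulr_suml.
rewrite E; under eq_cvg do rewrite E.
apply: cvg_big => [|k _]; first exact: add_continuous.
apply: cvg_big => [|l _]; first exact: add_continuous.
apply: cvgMr_tmp; apply: cvgMl_tmp.
exact: (cvg_comp _ _ ML (@coord_continuous _ _ _ l k L)).
Qed.

Lemma cvg_diag_entry (R : realType) (n : nat) (F : set_system R)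
    (M : R -> 'B[R]_n) (L U : 'B[R]_n) (i : 'I_n) :
  Filter F -> M @ F --> L ->
  (fun t => diag_entry U (M t) i) @ F --> diag_entry U L i.
Proof. by move=> FF ML; apply: cvg_Re; apply: cvg_entry_sandwich. Qed.

Lemma right_limit_ge0 (R : realType) (f : R -> R) (l : R) :
  f @ 0^'+ --> l -> (forall t, 0 < t -> 0 <= f t) -> 0 <= l.
Proof.
move=> fl f0; apply: (cvgr_to_ge fl).
by near=> t; apply: f0; near: t; exact: nbhs_right_gt.
Unshelve. all: by end_near. Qed.

Lemma right_limit_eq0 (R : realType) (f : R -> R) (l : R) :
  f @ 0^'+ --> l -> (forall t, 0 < t -> f t = 0) -> l = 0.
Proof.
move=> fl f0; apply/eqP; rewrite eq_le -oppr_ge0.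
rewrite (right_limit_ge0 fl) ?andbT => [|t /f0 ->//].
by apply: (right_limit_ge0 (cvgN fl)) => t /f0 ft; rewrite fctE ft oppr0.
Qed.

(** * The Markov chain of an eigenbasis *)

Lemma diag_entryD (R : realType) (n : nat) (U M N : 'B[R]_n) (i : 'I_n) :
  diag_entry U (M + N) i = diag_entry U M i + diag_entry U N i.
Proof. by rewrite /diag_entry mulmxDr mulmxDl mxE ReD. Qed.

Lemma diag_entryN (R : realType) (n : nat) (U M : 'B[R]_n) (i : 'I_n) :
  diag_entry U (- M) i = - diag_entry U M i.
Proof. by rewrite /diag_entry mulmxN mulNmx mxE ReN. Qed.

Lemma diag_entryZ (R : realType) (n : nat) (c : R) (U M : 'B[R]_n) (i : 'I_n) :
  diag_entry U ((c%:C : C R) *: M) i = c * diag_entry U M i.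
Proof. by rewrite /diag_entry -scalemxAr -scalemxAl mxE ReZ. Qed.

Lemma diag_entry0 (R : realType) (n : nat) (U : 'B[R]_n) (i : 'I_n) :
  diag_entry U 0 i = 0.
Proof. by rewrite /diag_entry mulmx0 mul0mx mxE. Qed.

Lemma diag_entry_sum (R : realType) (n : nat) (I : finType) (U : 'B[R]_n)
    (F : I -> 'B[R]_n) (i : 'I_n) :
  diag_entry U (\sum_k F k) i = \sum_k diag_entry U (F k) i.
Proof.
apply: (big_morph (fun M => diag_entry U M i)); last exact: diag_entry0.
by move=> M N; rewrite diag_entryD.
Qed.

Lemma diag_entry_adj (R : realType) (n : nat) (U M : 'B[R]_n) (i : 'I_n) :
  diag_entry U (M^t*) i = diag_entry U M i.
Proof.
have -> : diag_entry U (M^t*) i = Re (((U *m M *m U^t*)^t*) i i).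
  by rewrite !adjM trmxCK mulmxA.
by rewrite 2!mxE Re_conj.
Qed.

Lemma diag_entry_mull (R : realType) (n : nat) (U M : 'B[R]_n) (x : 'I_n -> R)
    (i : 'I_n) : U \is unitarymx ->
  diag_entry U (diag_in U x *m M) i = x i * diag_entry U M i.
Proof.
move=> Uu; rewrite /diag_entry /diag_in !mulmxA unitary_mul// mul1mx -!mulmxA.
by rewrite mul_diag_mx !mxE ReZ.
Qed.

Definition basis_proj (R : realType) (n : nat) (U : 'B[R]_n) (j : 'I_n) :
    'B[R]_n := diag_in U (fun i => (i == j)%:R).

(** For distinct i and j, the rate at which the transition probability
    <i| P_t(P_j) |i> leaves 0. *)
Definition rates_in (R : realType) (n : nat) (L : 'B[R]_n -> 'B[R]_n)
    (U : 'B[R]_n) (i j : 'I_n) : R := diag_entry U (L (basis_proj U j)) i.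

Lemma tr_basis_proj (R : realType) (n : nat) (U M : 'B[R]_n) (i : 'I_n) :
  Re (\tr ((basis_proj U i)^t* *m M)) = diag_entry U M i.
Proof.
rewrite diag_in_adj tr_diag_in_mul Re_sum (bigD1 i)//= eqxx ReZ mul1r.
rewrite big1 ?addr0// => j ji.
by rewrite ReZ (negbTE ji) mul0r.
Qed.

Lemma diag_entry_basis_proj (R : realType) (n : nat) (U : 'B[R]_n) (i j : 'I_n) :
  U \is unitarymx -> diag_entry U (basis_proj U j) i = (i == j)%:R.
Proof.
move=> Uu; rewrite -[basis_proj U j]mulmx1 diag_entry_mull//.
by rewrite /diag_entry mulmx1 unitary_mul// mxE eqxx mulr1.
Qed.

Lemma diag_entry_linear (R : realType) (n : nat)
    (L : {linear 'B[R]_n -> 'B[R]_n}) (U : 'B[R]_n) (x : 'I_n -> R) (i : 'I_n) :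
  diag_entry U (L (diag_in U x)) i = rate_op (rates_in L U) x i.
Proof.
rewrite diag_in_sum linear_sum diag_entry_sum; apply: eq_bigr => j _.
by rewrite linearZ diag_entryZ mulrC.
Qed.


(** The generator is known only as a limit of difference quotients, so properties
    of the semigroup pass to it through their diagonal entries. *)
Lemma generator_entry (R : realType) (n : nat)
    (P : R -> {linear 'B[R]_n -> 'B[R]_n}) (L : {linear 'B[R]_n -> 'B[R]_n})
    (U X : 'B[R]_n) (i : 'I_n) : generator P L ->
  t^-1 * (diag_entry U (P t X) i - diag_entry U X i) @[t --> 0^'+]
    --> diag_entry U (L X) i.
Proof.
move=> /(_ X) /(cvg_diag_entry (U := U) (i := i) _).
by under eq_cvg do rewrite diag_entryZ diag_entryD diag_entryN.
Qed.

Lemma Re_tr_adj (R : realType) (n : nat) (M : 'B[R]_n) :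
  Re (\tr (M^t*)) = Re (\tr M).
Proof. by rewrite trace_map_mx mxtrace_tr; exact: Re_conj. Qed.

Lemma semigroup_entry_sym (R : realType) (n : nat)
    (P : R -> {linear 'B[R]_n -> 'B[R]_n}) (U : 'B[R]_n) (i j : 'I_n) (t : R) :
    symmetric_semigroup P -> 0 <= t ->
  diag_entry U (P t (basis_proj U j)) i = diag_entry U (P t (basis_proj U i)) j.
Proof.
move=> sym t0.
apply: etrans (esym (tr_basis_proj U (P t (basis_proj U j)) i)) _.
apply: etrans _ (tr_basis_proj U (P t (basis_proj U i)) j).
apply: etrans (congr1 (@complex.Re R) (sym t _ _ t0)) _.
by rewrite -Re_tr_adj adjM trmxCK.
Qed.

(** Each property is that of the difference quotients: <i| P_t(P_j) |i> is
    symmetric in i and j by symmetry of the semigroup, nonnegative by positivity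
    and initially 0 when i and j differ, and its sum over j is 1. *)
Lemma symmetric_rates_in (R : realType) (n : nat)
    (P : R -> {linear 'B[R]_n -> 'B[R]_n}) (L : {linear 'B[R]_n -> 'B[R]_n})
    (U : 'B[R]_n) :
    quantum_markov_semigroup P -> generator P L -> symmetric_semigroup P ->
    U \is unitarymx ->
  symmetric_rates (rates_in L U).
Proof.
move=> [_ _ _ cp P1] gen sym Uu; split.
- move=> i j; apply/eqP; rewrite -subr_eq0; apply/eqP.
  have lim := cvgB (generator_entry (U := U) (X := basis_proj U j) (i := i) gen)
    (generator_entry (U := U) (X := basis_proj U i) (i := j) gen).
  apply: (right_limit_eq0 (lim _)) => t t0.
  have e1 := semigroup_entry_sym U i j sym (ltW t0).
  have e2 : diag_entry U (basis_proj U j) i = diag_entry U (basis_proj U i) j.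
    apply: etrans (diag_entry_basis_proj i j Uu) _.
    apply: etrans _ (esym (diag_entry_basis_proj j i Uu)).
    by rewrite eqtype.eq_sym.
  rewrite !fctE -mulrBr; apply/eqP.
  rewrite mulf_eq0 subr_eq0; apply/orP; right; apply/eqP.
  exact: (congr2 (fun u v => u - v) e1 e2).
- move=> i j ij.
  apply: (right_limit_ge0 (generator_entry (U := U) (X := (basis_proj U j)) (i := i) gen)) => t t0.
  rewrite diag_entry_basis_proj// (negbTE ij) subr0.
  rewrite mulr_ge0 ?invr_ge0 ?(ltW t0)// diag_entry_psd//.
  apply: completely_positive_psd; first by apply: cp; rewrite ltW.
  by apply: diag_in_psd => k; rewrite ler0n.
move=> i; transitivity (rate_op (rates_in L U) (fun=> 1) i).
  by apply: eq_bigr => j _; rewrite mulr1.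
rewrite -diag_entry_linear diag_in_cst//.
apply: (right_limit_eq0 (generator_entry (U := U) (X := 1%:M) (i := i) gen)) => t t0.
by rewrite P1 ?(ltW t0)// subrr mulr0.
Qed.

(** Positive maps send positive operators to self-adjoint ones, and
    self-adjointness passes to the limit of the difference quotients. *)
Lemma generator_herm (R : realType) (n : nat)
    (P : R -> {linear 'B[R]_n -> 'B[R]_n}) (L : {linear 'B[R]_n -> 'B[R]_n})
    (X : 'B[R]_n) :
    quantum_markov_semigroup P -> generator P L -> psdmx X ->
  L X \is hermsymmx.
Proof.
move=> [_ _ _ cp _] gen Xp; rewrite hermE; apply/eqP/matrixP => i j.
pose D t : 'B[R]_n := ((t^-1)%:C : C R) *: (P t X - X).
have Dh t i0 j0 : 0 < t -> Num.conj (D t j0 i0) = D t i0 j0.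
  move=> t0; have [h _] : psdmx (P t X).
    exact: (completely_positive_psd (cp t (ltW t0)) Xp).
  have [h' _] := Xp.
  move: h h'; rewrite !hermE => /eqP/matrixP/(_ i0 j0) + /eqP/matrixP/(_ i0 j0).
  rewrite !mxE => e1 e2.
  by rewrite rmorphM rmorphB /= e1 e2; congr (_ * _); exact: conj_real.
have DL (c : C R) k l : (fun t => Re (c * D t k l)) @ 0^'+ --> Re (c * L X k l).
  apply: cvg_Re; apply: cvgMl_tmp.
  exact: (cvg_comp _ _ (gen X) (@coord_continuous _ _ _ k l (L X))).
have ImE (z : C R) : Im z = - Re ('i%C * z).
  by case: z => a b /=; rewrite mul0r mul1r sub0r opprK.
(* Real and imaginary parts are compared separately, as limits of real functions. *)
have eRe : Re (L X j i) = Re (L X i j).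
  have lim := cvgB (DL 1 j i) (DL 1 i j).
  apply/eqP; rewrite -subr_eq0 -[L X j i]mul1r -[L X i j]mul1r; apply/eqP.
  apply: (right_limit_eq0 (lim _)) => t t0.
  by rewrite !fctE !mul1r -(Dh t i j t0) Re_conj subrr.
have eIm : Im (L X j i) = - Im (L X i j).
  have lim := cvgD (DL 'i%C j i) (DL 'i%C i j).
  apply/eqP; rewrite -subr_eq0 opprK !ImE -opprD oppr_eq0; apply/eqP.
  apply: (right_limit_eq0 (lim _)) => t t0.
  rewrite !fctE -(Dh t i j t0); case: (D t j i) => a b /=.
  by ring.
rewrite !mxE; move: eRe eIm; case: (L X j i) (L X i j) => a b [c e] /= -> ->.
by apply/eqP; rewrite eq_complex /= opprK !eqxx.
Qed.


(** The operator L (X^* X) is self-adjoint because X^* X is positive, and the other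
    two terms are adjoint to each other. *)
Lemma carre_du_champ_herm (R : realType) (n : nat)
    (P : R -> {linear 'B[R]_n -> 'B[R]_n}) (L : {linear 'B[R]_n -> 'B[R]_n})
    (X : 'B[R]_n) :
    quantum_markov_semigroup P -> generator P L ->
  carre_du_champ L X X \is hermsymmx.
Proof.
move=> qms gen; have XXp : psdmx (X^t* *m X).
  split; first by rewrite hermE adjM trmxCK.
  move=> v; rewrite (_ : v^t* *m _ *m v = (X *m v)^t* *m (X *m v)); last first.
    by rewrite adjM !mulmxA.
  rewrite mxE sumr_ge0// => k _; rewrite !mxE mulrC.
  exact: mul_conjC_ge0.
have := generator_herm qms gen XXp; rewrite !hermE => /eqP h.
apply/eqP/matrixP => i j; rewrite /carre_du_champ.
have -> : (2^-1 : C R) = ((2^-1 : R)%:C : C R).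
  by rewrite fmorphV rmorph_nat.
rewrite 3!mxE rmorphM [RHS]mxE; congr (_ * _); first exact: conj_real.
transitivity ((L (X^t* *m X) - X^t* *m L X - (L X)^t* *m X)^t* i j).
  by rewrite !mxE.
by rewrite !adjB !adjM !trmxCK h addrAC.
Qed.

(** In the eigenbasis the terms of Gamma(X) become x_j^2, x_i x_j and x_i x_j
    averaged against Q; the missing x_i^2 comes for free from the zero row sums. *)
Lemma diag_entry_carre_du_champ (R : realType) (n : nat)
    (L : {linear 'B[R]_n -> 'B[R]_n}) (U : 'B[R]_n) (x : 'I_n -> R) (i : 'I_n) :
    U \is unitarymx -> symmetric_rates (rates_in L U) ->
  diag_entry U (carre_du_champ L (diag_in U x) (diag_in U x)) i
  = rate_gamma (rates_in L U) x i.
Proof.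
move=> Uu [_ _ Q1]; rewrite /carre_du_champ diag_in_adj diag_inM//.
have -> : (2^-1 : C R) = ((2^-1 : R)%:C : C R).
  by rewrite fmorphV rmorph_nat.
rewrite diag_entryZ 2!diag_entryD !diag_entryN /rate_gamma; congr (_ * _).
have -> : diag_entry U ((L (diag_in U x))^t* *m diag_in U x) i
    = diag_entry U (diag_in U x *m L (diag_in U x)) i.
  by rewrite -diag_entry_adj adjM trmxCK diag_in_adj.
have eM := etrans (diag_entry_mull (L (diag_in U x)) x i Uu)
  (congr1 (fun z => x i * z) (diag_entry_linear L U x i)).
transitivity (rate_op (rates_in L U) (fun k => x k * x k) i
   - x i * rate_op (rates_in L U) x i - x i * rate_op (rates_in L U) x i).
  by congr (_ - _ - _); [exact: diag_entry_linear|exact: eM|exact: eM].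
transitivity (rate_op (rates_in L U) (fun k => x k * x k) i
   - x i * rate_op (rates_in L U) x i - x i * rate_op (rates_in L U) x i
   + (\sum_j rates_in L U i j) * x i ^+ 2).
  by rewrite Q1 mul0r addr0.
rewrite !mulr_sumr mulr_suml -!sumrN -!big_split/=.
by apply: eq_bigr => j _; ring.
Qed.

(** Each diagonal entry of M is an average of its eigenvalues with weights |W i k|^2,
    where W is unitary: apply Jensen's inequality, then sum over i, the weights
    being doubly stochastic. *)
Lemma peierls (R : realType) (n : nat) (U M : 'B[R]_n) (q : R) :
    U \is unitarymx -> M \is hermsymmx -> 1 <= q ->
  mean (fun i => `|diag_entry U M i| `^ q) <= nschatten q M `^ q.
Proof.
move=> Uu Mh q1; rewrite (diag_in_exists Mh).
set V := spectralmx M; set g := fun i => Re (spectral_diag M 0 i).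
have Vu : V \is unitarymx by apply: spectral_unitarymx.
have q0 : 0 < q by lra.
have mg : 0 <= mean (fun i => `|g i| `^ q) by apply: mean_ge0 => i; rewrite powR_ge0.
rewrite nschatten_diag_in// -powRrM mulVf ?gt_eqF// powRr1//.
have [W WE] : exists W, W = U *m V^t* by exists (U *m V^t*).
pose l i k := Re (W i k * Num.conj (W i k)).
have l0 i k : 0 <= l i k.
  by have := mul_conjC_ge0 (W i k); rewrite lecE => /andP[].
have lr i : \sum_k l i k = 1.
  have : (W *m W^t*) i i = 1.
    rewrite WE adjM trmxCK -mulmxA [V^t* *m _]mulmxA unitary_mulC// mul1mx.
    by rewrite unitary_mul// mxE eqxx.
  rewrite mxE => /(congr1 (@complex.Re R)); rewrite Re_sum => e.
  apply: etrans e.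
  by apply: eq_bigr => k _; rewrite !mxE.
(* W is unitary on both sides, so the weights also sum to 1 over i. *)
have lc k : \sum_i l i k = 1.
  have : (W^t* *m W) k k = 1.
    rewrite WE adjM trmxCK -mulmxA [U^t* *m _]mulmxA unitary_mulC// mul1mx.
    by rewrite unitary_mul// mxE eqxx.
  rewrite mxE => /(congr1 (@complex.Re R)); rewrite Re_sum => e.
  apply: etrans e.
  by apply: eq_bigr => i _; rewrite !mxE mulrC.
have dE i : diag_entry U (diag_in V g) i = \sum_k l i k * g k.
  have -> : diag_entry U (diag_in V g) i
      = Re ((W *m diag_mx (\row_k ((g k)%:C : C R)) *m W^t*) i i).
    by rewrite /diag_entry /diag_in WE adjM trmxCK !mulmxA.
  rewrite -mulmxA mxE Re_sum; apply: eq_bigr => k _.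
  by rewrite mul_diag_mx 2!mxE !mxE mulrCA ReZ mulrC.
apply: (@le_trans _ _ (mean (fun i => \sum_k l i k * `|g k| `^ q))).
  apply: le_mean => i; rewrite dE.
  apply: (le_trans _ (jensen_powR (l0 i) (lr i) (fun k => normr_ge0 (g k)) q1)).
  rewrite ge0_ler_powR ?nnegrE ?(ltW q0)//.
    by apply: sumr_ge0 => k _; rewrite mulr_ge0.
  apply: (le_trans (ler_norm_sum _ _ _)); apply: ler_sum => k _.
  by rewrite normrM ger0_norm.
rewrite /mean exchange_big/= le_eqVlt; apply/orP; left; apply/eqP.
by congr (_ * _); apply: eq_bigr => k _; rewrite -mulr_suml lc mul1r.
Qed.

(** Replacing alpha by the smaller constant c p is possible because the difference
    of norms on the left is nonnegative. *)
Lemma diagonal_beckner_in (R : realType) (n : nat)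
    (L : {linear 'B[R]_n -> 'B[R]_n}) (U : 'B[R]_n) (c : R -> R) :
    (0 < n)%N -> U \is unitarymx ->
    (forall p : R, 1 < p -> p <= 2 ->
       exists alpha : R, c p <= alpha /\ beckner_inequality L p alpha) ->
  diagonal_beckner (rates_in L U) c.
Proof.
move=> n0 Uu bk p f p1 p2 f0.
have [alpha [ca /(_ _ (diag_in_pd Uu f0))]] := bk p p1 p2.
have p0 : 0 < p by lra.
have p10 : 0 < p - 1 by lra.
have fE : mean (fun i => `|f i|) = mean f.
  by apply: eq_mean => i; rewrite gtr0_norm.
rewrite !(nschatten_diag_in _ _ Uu) -powRrM (mulVf (lt0r_neq0 p0)).
have -> : mean (fun i => `|f i| `^ p) = mean (fun i => f i `^ p).
  by apply: eq_mean => i; rewrite gtr0_norm.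
have -> : mean (fun i => `|f i| `^ 1) = mean f.
  by apply: eq_mean => i; rewrite gtr0_norm// powRr1 ?ltW.
have m0 : 0 <= mean f by apply: mean_ge0 => i; rewrite ltW.
have mp : 0 <= mean (fun i => f i `^ p).
  by apply: mean_ge0 => i; rewrite powR_ge0.
rewrite invr1 !powRr1// /p_dirichlet_form /powmx funmx_diag_in// ntr_diag_in_mul.
have -> : mean (fun i => ((fun x => x `^ (p - 1)) \o f) i
                         * diag_entry U (L (diag_in U f)) i)
    = mean (fun i => f i `^ (p - 1) * rate_op (rates_in L U) f i).
  by apply: eq_mean => i; rewrite diag_entry_linear.
apply: le_trans; rewrite ler_wpM2r//.
  by rewrite subr_ge0 jensen_mean// ?ltW// => i; rewrite ltW.
by rewrite ler_wpM2r// divr_ge0// ltW.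
Qed.

(** * The moment estimate *)

Lemma primitive_dim_gt0 (R : realType) (d : nat)
    (P : R -> {linear 'B[R]_d -> 'B[R]_d}) : primitive P -> (0 < d)%N.
Proof.
case=> rho [[_ tr1 _] _ _]; rewrite lt0n; apply/eqP => d0.
move: tr1; rewrite /mxtrace big1 => [/esym/eqP|i _]; first by rewrite oner_eq0.
by have := ltn_ord i; rewrite {2}d0.
Qed.

Lemma mxtrace_diag_in (R : realType) (n : nat) (U : 'B[R]_n) (x : 'I_n -> R) :
  U \is unitarymx -> \tr (diag_in U x) / n%:R = ((mean x)%:C : C R).
Proof.
move=> Uu; rewrite -[diag_in U x]mulmx1 tr_diag_in_mul.
rewrite /mean rmorphM rmorph_sum fmorphV rmorph_nat mulrC; congr (_ * _).
by apply: eq_bigr => i _; rewrite mulmx1 unitary_mul// mxE eqxx mulr1.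
Qed.

Unset Implicit Arguments.

Theorem proposition3p35 (R : realType) (d : nat)
    (P : R -> {linear 'B[R]_d -> 'B[R]_d})
    (L : {linear 'B[R]_d -> 'B[R]_d})
    (P_qms : quantum_markov_semigroup P)
    (L_gen : generator P L)
    (P_sym : symmetric_semigroup P)
    (P_prim : primitive P)
    (a s : R) (a_gt0 : 0 < a) (s_ge0 : 0 <= s)
    (beckner : forall p : R, 1 < p -> p <= 2 ->
       exists alpha : R,
         a * (p - 1) `^ s <= alpha /\ beckner_inequality L p alpha)
    (X : 'B[R]_d) (X_sa : X \is hermsymmx)
    (r : R) (r_ge2 : 2 <= r) :
  nschatten r (X - (\tr X / d%:R)%:M) ^+ 2
    <= r `^ (s + 1) * kappa s / (2 * a)
       * nschatten (r / 2) (carre_du_champ L X X).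
Proof.
have d0 := primitive_dim_gt0 P_prim.
set G := nschatten _ (carre_du_champ L X X).
have [U Uu [x XE]] : exists2 U : 'B[R]_d, U \is unitarymx &
    exists x, X = diag_in U x.
  exists (spectralmx X); first exact: spectral_unitarymx.
  by eexists; exact: diag_in_exists.
have Qs := symmetric_rates_in P_qms L_gen P_sym Uu.
have -> : nschatten r (X - (\tr X / d%:R)%:M)
    = mean (fun i => `|x i - mean x| `^ r) `^ r^-1.
  rewrite XE mxtrace_diag_in// -(diag_in_cst _ Uu) diag_inB.
  exact: nschatten_diag_in.
apply: (moment_bound d0 Qs a_gt0 s_ge0 r_ge2); first exact: powR_ge0.
  exact: diagonal_beckner_in.
have r1 : 1 <= r / 2 by rewrite ler_pdivlMr// mul1r.
have := peierls Uu (carre_du_champ_herm X P_qms L_gen) r1.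
rewrite -/G XE; apply: le_trans; apply: le_mean => i.
rewrite diag_entry_carre_du_champ// ger0_norm//.
exact: rate_gamma_ge0.
Qed.
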